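(* Let $G'=\{x\rightarrow y,\ y\rightarrow x\}$. (i) For $n\geqslant 1$, we have $$(xD_{G'})^n=\sum_{k=1}^n\sum_{\ell=0}^{\lfloor(2n-k)/2\rfloor}W_{n,k,\ell}x^{k+2\ell} y^{n-k-2\ell}D_{G'}^k,$$ where the coefficients $W_{n,k,\ell}$ satisfy the recurrence relation $$W_{n+1,k,\ell}=(k+2\ell) W_{n,k,\ell}+(n-k-2\ell+2)W_{n,k,\ell-1}+W_{n,k-1,\ell},$$ with the initial conditions $W_{1,1,0}=1$ and $W_{1,k,\ell}=0$ if $(k,\ell)\neq (1,0)$. (ii) Let $W_n(x,y,z)=\sum_{k=1}^n\sum_{\ell=0}^{\lfloor(2n-k)/2\rfloor}W_{n,k,\ell}x^{k+2\ell} y^{n-k-2\ell}z^k$ for $n\geqslant1$. Then $$W_{n+1}(x,y,z)=x\left(z+n\frac{x}{y}\right)W_n(x,y,z)+xy\left(1-\frac{x^2}{y^2}\right)\frac{\partial}{\partial x}W_n(x,y,z),$$ with the initial condition $W_0(x,y,z)=1$. In particular, for $n\geqslant 1$, $$W_n(1,1,z)=z(z+1)(z+2)\cdots(z+n-1)=\sum_{k=1}^n\genfrac{[}{]}{0pt}{}{n}{k}z^k,$$ $$W_n(x,y,1)=y^nT_n\left(\frac{x}{y}\right),$$ where $T_n(x)$ is the up-down run polynomial over permutations in $\mathfrak{S}_n$.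
   Context: Grammars: a grammar $G$ on commuting variables is a set of substitution rules $v\rightarrow f_v$; $D_G$ is the derivation (linear, Leibniz rule, killing constants) on functions (e.g. polynomials or Laurent polynomials) in the variables with $D_G(v)=f_v$. For a function $w$, $wD_G$ is the operator $f\mapsto wD_G(f)$, and $(wD_G)^n$ is its $n$-fold composition; in expansions $\sum_k c_kD_G^k$ the functions $c_k$ act by multiplication. $\genfrac{[}{]}{0pt}{}{n}{k}$ is the signless Stirling number of the first kind (number of permutations of $[n]$ with $k$ cycles). $\mathfrak{S}_n$ is the symmetric group on $[n]$. For $\pi\in\mathfrak{S}_n$, $\operatorname{udrun}(\pi)$ is the number of up-down runs of $\pi$, i.e. the number of alternating runs (maximal monotone, increasing or decreasing, runs of consecutive entries) of the word $0\,\pi(1)\pi(2)\cdots\pi(n)$. $T_n(x)=\sum_{\pi\in\mathfrak{S}_n}x^{\operatorname{udrun}(\pi)}$, with $T_0(x)=1$, $T_1(x)=x$. *)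

(* Defs.v *)
From HB Require Import structures.
From mathcomp Require Export all_boot all_order all_algebra perm ring.
From mathcomp Require Export mpoly fraction generic_quotient.

Set Implicit Arguments.
Unset Strict Implicit.
Unset Printing Implicit Defensive.

Import GRing.Theory.
Local Open Scope ring_scope.

Local Notation tofrac := (@FracField.tofrac _).

(* Functions of n commuting variables over the field of constants F are
   rational functions: they contain the polynomials and the Laurent polynomials
   as subrings. *)
Notation ratfun F n := {fraction {mpoly F[n]}}.

Definition rvar (F : fieldType) (n : nat) (i : 'I_n) : ratfun F n :=
  tofrac ('X_i : {mpoly F[n]}).

(* Extension of a derivation d of R to the field of fractions: the quotient rule
   applied to an arbitrary representative p / q of a; fderivE shows that the
   choice of the representative is irrelevant. *)
Definition fderiv (R : idomainType) (d : R -> R) (a : {fraction R}) :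
    {fraction R} :=
  let p := \n_(repr a) in let q := \d_(repr a) in
  tofrac (d p * q - p * d q) / tofrac (q ^+ 2).

Definition pderiv (F : fieldType) (n : nat) (i : 'I_n) :
    ratfun F n -> ratfun F n :=
  fderiv (@mderiv n F i).

(* A grammar assigns to the variable i the right-hand side g i of its rule;
   gderiv g is the associated derivation. *)
Definition gderiv (F : fieldType) (n : nat) (g : 'I_n -> ratfun F n)
    (a : ratfun F n) : ratfun F n :=
  \sum_(i < n) g i * pderiv i a.

(* x = rvar 0 and y = rvar 1; the rules are x -> y and y -> x. *)
Definition Gprime (F : fieldType) (i : 'I_2) : ratfun F 2 :=
  rvar F (if i == 0 then 1 else 0).

(* Value at x, y, z of the generating function of W in row n. The exponent of y
   is an integer, possibly negative, and the row n = 0 is 1 by convention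
   (the sum is empty there). *)
Definition Wfun (K : fieldType) (W : nat -> int -> int -> int)
    (n : nat) (x y z : K) : K :=
  if n is 0 then 1 else
  \sum_(1 <= k < n.+1) \sum_(0 <= l < ((2 * n - k) %/ 2).+1)
    (W n k%:Z l%:Z)%:~R * x ^+ (k + 2 * l) *
    y ^ (n%:Z - k%:Z - 2 * l%:Z) * z ^+ k.

(* The consecutive entries of w at the positions i, ..., j. *)
Definition factor (w : seq nat) (i j : nat) : seq nat := drop i (take j.+1 w).

(* At least two consecutive entries, all increasing or all decreasing. *)
Definition monotone_factor (w : seq nat) (i j : nat) : bool :=
  (i < j)%N && (sorted ltn (factor w i j) || sorted gtn (factor w i j)).

Definition alternating_run (w : seq nat) (i j : 'I_(size w)) : bool :=
  monotone_factor w i j &&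
  [forall i' : 'I_(size w), forall j' : 'I_(size w),
     [&& (i' <= i)%N, (j <= j')%N & monotone_factor w i' j'] ==>
     ((i' == i) && (j' == j))].

Definition altruns (w : seq nat) : nat :=
  #|[set r : 'I_(size w) * 'I_(size w) | alternating_run r.1 r.2]|.

(* 'S_n permutes {0, ..., n - 1}, hence the shift by one. *)
Definition udrun (n : nat) (s : 'S_n) : nat :=
  altruns (0%N :: [seq (s i).+1 | i <- enum 'I_n]).

Definition Tpoly (R : nzRingType) (n : nat) : {poly R} :=
  \sum_(s : 'S_n) 'X^(udrun s).

Definition stirling1 (n k : nat) : nat := #|[set s : 'S_n | #|porbits s| == k]|.

Lemma frac_repr (R : idomainType) (c : {fraction R}) :
  c = tofrac \n_(repr c) / tofrac \d_(repr c).
Proof.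
have d0 : \d_(repr c) != 0 by exact: denom_ratioP.
apply: (@mulIf _ (tofrac \d_(repr c))); first by rewrite tofrac_eq0.
rewrite mulfVK ?tofrac_eq0 // -{1}[c]reprK.
unlock FracField.tofrac; rewrite -[LHS]FracField.pi_mul.
apply/eqmodP; rewrite /= FracField.equivfE /FracField.mulf.
by rewrite !numden_Ratio ?(oner_neq0, mulf_neq0) // !mulr1 mulrC.
Qed.

Lemma fderivE (R : idomainType) (d : R -> R) (p q : R) :
  (forall a b, d (a * b) = d a * b + a * d b) -> q != 0 ->
  fderiv d (tofrac p / tofrac q) =
    tofrac (d p * q - p * d q) / tofrac (q ^+ 2).
Proof.
move=> dM q0; rewrite /fderiv.
have := frac_repr (tofrac p / tofrac q).
have := denom_ratioP (repr (tofrac p / tofrac q)).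
move: (\n_(repr (tofrac p / tofrac q))) (\d_(repr (tofrac p / tofrac q))).
move=> P Q Q0 /eqP; rewrite eqr_div ?tofrac_eq0 // -!tofracM tofrac_eq.
move=> /eqP E; have dE := congr1 d E; rewrite !dM in dE.
apply/eqP; rewrite eqr_div ?tofrac_eq0 ?expf_neq0 // -!tofracM tofrac_eq.
rewrite -subr_eq0.
suff -> : (d P * Q - P * d Q) * q ^+ 2 - (d p * q - p * d q) * Q ^+ 2
     = (d P * q + P * d q - (d p * Q + p * d Q)) * (q * Q)
       + (p * Q - P * q) * (d q * Q + q * d Q).
  by rewrite dE E !subrr !mul0r addr0.
by ring.
Qed.

Lemma fderiv_tofrac (R : idomainType) (d : R -> R) (p : R) :
  (forall a b, d (a * b) = d a * b + a * d b) ->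
  fderiv d (tofrac p) = tofrac (d p).
Proof.
move=> dM; have d1 : d 1 = 0.
  by apply: (@addrI _ (d 1)); rewrite addr0 -{3}[1]mulr1 dM mulr1 mul1r.
have := fderivE p dM (oner_neq0 _).
by rewrite expr1n tofrac1 !divr1 d1 mulr1 mulr0 subr0.
Qed.

Lemma fderivD (R : idomainType) (d : R -> R) :
  {morph d : a b / a + b} -> (forall a b, d (a * b) = d a * b + a * d b) ->
  {morph fderiv d : a b / a + b}.
Proof.
move=> dD dM a b.
have qa := denom_ratioP (repr a); have qb := denom_ratioP (repr b).
rewrite (frac_repr a) (frac_repr b).
move: qb qa; move: (\n_(repr a)) (\d_(repr a)) (\n_(repr b)) (\d_(repr b)).
move=> p q r s s0 q0.
rewrite addf_div ?tofrac_eq0 // -!tofracM -tofracD !fderivE ?mulf_neq0 //.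
rewrite addf_div ?tofrac_eq0 ?expf_neq0 // -!tofracM -tofracD.
apply/eqP; rewrite eqr_div ?tofrac_eq0 ?(expf_neq0, mulf_neq0) //.
by rewrite -!tofracM tofrac_eq dD !dM; apply/eqP; ring.
Qed.

Lemma fderivM (R : idomainType) (d : R -> R) (a b : {fraction R}) :
  (forall a b, d (a * b) = d a * b + a * d b) ->
  fderiv d (a * b) = fderiv d a * b + a * fderiv d b.
Proof.
move=> dM.
have qa := denom_ratioP (repr a); have qb := denom_ratioP (repr b).
rewrite (frac_repr a) (frac_repr b).
move: qb qa; move: (\n_(repr a)) (\d_(repr a)) (\n_(repr b)) (\d_(repr b)).
move=> p q r s s0 q0.
rewrite mulf_div -!tofracM !fderivE ?mulf_neq0 //.
rewrite !mulf_div -!tofracM addf_div ?tofrac_eq0 ?(expf_neq0, mulf_neq0) //.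
rewrite -!tofracM -tofracD.
apply/eqP; rewrite eqr_div ?tofrac_eq0 ?(expf_neq0, mulf_neq0) //.
by rewrite -!tofracM tofrac_eq !dM; apply/eqP; ring.
Qed.

Lemma pderivD (F : fieldType) (n : nat) (i : 'I_n) :
  {morph @pderiv F n i : a b / a + b}.
Proof. exact: (fderivD (mderivD i) (mderivM i)). Qed.

Lemma pderivM (F : fieldType) (n : nat) (i : 'I_n) (a b : ratfun F n) :
  pderiv i (a * b) = pderiv i a * b + a * pderiv i b.
Proof. exact: (fderivM _ _ (mderivM i)). Qed.

Lemma pderiv_poly (F : fieldType) (n : nat) (i : 'I_n) (p : {mpoly F[n]}) :
  pderiv i (tofrac p) = tofrac (mderiv i p).
Proof. exact: (fderiv_tofrac _ (mderivM i)). Qed.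

Lemma gderivD (F : fieldType) (n : nat) (g : 'I_n -> ratfun F n) :
  {morph gderiv g : a b / a + b}.
Proof.
move=> a b; rewrite /gderiv -big_split /=.
by apply: eq_bigr => i _; rewrite pderivD mulrDr.
Qed.

Lemma gderivM (F : fieldType) (n : nat) (g : 'I_n -> ratfun F n) a b :
  gderiv g (a * b) = gderiv g a * b + a * gderiv g b.
Proof.
rewrite /gderiv mulr_suml mulr_sumr -big_split /=; apply: eq_bigr => i _.
by rewrite pderivM mulrDr mulrA [a * (_ * _)]mulrCA.
Qed.

Lemma gderiv_const (F : fieldType) (n : nat) (g : 'I_n -> ratfun F n) (c : F) :
  gderiv g (tofrac c%:MP) = 0.
Proof.
by rewrite /gderiv big1 // => i _; rewrite pderiv_poly mderivC tofrac0 mulr0.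
Qed.

Lemma gderiv_var (F : fieldType) (n : nat) (g : 'I_n -> ratfun F n) (i : 'I_n) :
  gderiv g (rvar F i) = g i.
Proof.
rewrite /gderiv (bigD1 i) //= big1 => [|j ne_ji].
  rewrite pderiv_poly mderivX mnm1E eqxx scale1r -[X in (X - _)%MM]add0m addmK mpolyX0 tofrac1.
  by rewrite mulr1 addr0.
by rewrite pderiv_poly mderivX mnm1E eq_sym (negPf ne_ji) scale0r tofrac0 mulr0.
Qed.

(* Main.v *)
Require Import Defs.
From mathcomp Require Import zify.

(** The coefficients W are defined by their recurrence, started at the row
    n = 0 with a single entry 1 at (0, 0); the row n = 1 is then the one
    prescribed. Everything is read off from one summation identity.

    Write S n phi for the sum of W n k l * phi k l over all k and l
    ([rowsum]). Since the recurrence expresses the row n + 1 by shifts of the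
    row n, shifting the summation indices moves these shifts onto phi
    ([rowsumS]): S (n + 1) phi = S n phi', where
      phi' k l = (k + 2 l) phi k l + (n - k - 2 l) phi k (l + 1) + phi (k + 1) l.
    Each claim is the case of a suitable phi, by induction on n:
    - phi k l = x^(k+2l) y^(n-k-2l) D^k f gives (x D)^n f, because phi' is
      exactly what the Leibniz rule yields for x D applied to such a monomial
      ([iter_xD]);
    - phi k l = x^(k+2l) y^(n-k-2l) z^k gives W_n(x, y, z) and its differential
      recurrence ([WfunS]);
    - phi k l = z^k gives W_n(1, 1, z) = z (z + 1) ... (z + n - 1)
      ([rowsum_rising]);
    - phi k l = X^(k+2l) gives polynomials P_n with
      y^n P_n(x/y) = W_n(x, y, 1) and
      P_(n+1) = (X + n X^2) P_n + (X - X^3) P_n'.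

    What remains is combinatorial: the rising factorial counts permutations by
    cycles ([sum_porbits]), and the polynomials T_n satisfy the recurrence of
    the P_n ([TpolyS]). Both follow by building the permutations of n + 1
    points from those of n points, in n + 1 ways each ([sum_Sn_split]). For
    cycles, the new point n is fixed or multiplied by a transposition, which
    merges it into an existing cycle: a factor z + n. For up-down runs, the
    new maximum is inserted at each of the n + 1 places of the word. If the
    word 0 s(1) ... s(n) has r runs, the number of runs is kept at r places
    and grows by 1 at one place and by 2 at the n - r others ([peaksumE]), and
      r X^r + X^(r+1) + (n - r) X^(r+2)
        = (X + n X^2) X^r + (X - X^3) (X^r)'.

    Runs are counted through turns: alternating runs of a word with distinct
    entries correspond to their starting positions, that is, to the first step
    and to the steps whose direction differs from the preceding one
    ([altrunsE]). As the word starts with 0, its first step is a rise, so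
    imagining a descent before the word makes every run start at a change of
    direction ([altruns_turns]). *)

Set Implicit Arguments.
Unset Strict Implicit.
Unset Printing Implicit Defensive.

Import GRing.Theory.
Local Open Scope ring_scope.

(** * Coefficients of the powers of x D and sums over a row *)

(** The row 0 is chosen so that the recurrence also holds for n = 0; inductions
    then start from the trivial row. *)
Fixpoint xDcoef (n : nat) (k l : int) : int :=
  if n is m.+1 then
    (k + 2 * l) * xDcoef m k l + (m%:Z - k - 2 * l + 2) * xDcoef m k (l - 1)
    + xDcoef m (k - 1) l
  else ((k == 0) && (l == 0))%:R.

Lemma xDcoefS n k l : xDcoef n.+1 k l =
  (k + 2 * l) * xDcoef n k l + (n%:Z - k - 2 * l + 2) * xDcoef n k (l - 1)
  + xDcoef n (k - 1) l.
Proof. by []. Qed.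

Lemma xDcoef_support n k l : xDcoef n k l != 0 ->
  [/\ 0 <= k, k <= n%:Z, 0 <= l & k + 2 * l <= 2 * n%:Z]%R.
Proof.
elim: n k l => [|n IHn] k l /=.
  by case: (k =P 0) => [->|_]; case: (l =P 0) => [->|_]; rewrite ?eqxx.
have [->|/IHn] := eqVneq (xDcoef n k l) 0; last by case=> *; split; lia.
have [->|/IHn] := eqVneq (xDcoef n k (l - 1)) 0; last by case=> *; split; lia.
have [->|/IHn] := eqVneq (xDcoef n (k - 1) l) 0; last by case=> *; split; lia.
by rewrite !mulr0 !addr0 eqxx.
Qed.

Lemma xDcoef_out n k l :
  ~ [/\ 0 <= k, k <= n%:Z, 0 <= l & k + 2 * l <= 2 * n%:Z]%R ->
  xDcoef n k l = 0.
Proof. by move=> out; apply/eqP/negPn/negP => /xDcoef_support. Qed.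

Lemma xDcoef1 k l : (k, l) <> (1, 0) -> xDcoef 1 k l = 0.
Proof.
move=> ne_kl; rewrite xDcoefS /=.
have -> : (k - 1 == 0) && (l == 0) = false.
  by apply/andP => -[/eqP k1 /eqP l0]; apply: ne_kl; congr pair; lia.
case: (k =P 0) => [->|_]; last by rewrite !mulr0.
by case: (l =P 0) => [->|_]; case: (l - 1 =P 0) => E; rewrite ?mulr0 //=; lia.
Qed.

(** The operator (x D)^n with n > 0 has no term of order 0 in D. *)
Lemma xDcoefS0 n l : xDcoef n.+1 0 l = 0.
Proof.
have k_neg m j : xDcoef m (0 - 1) j = 0 by apply: xDcoef_out => -[].
elim: n l => [|n IHn] l; rewrite xDcoefS k_neg addr0; last first.
  by rewrite !IHn !mulr0.
rewrite /=; lia.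
Qed.

(** The square box 0 <= k, l <= n contains the support of the row n, by
    [xDcoef_support]. *)
Definition rowsum (R : pzRingType) (n : nat) (phi : nat -> nat -> R) : R :=
  \sum_(0 <= k < n.+1) \sum_(0 <= l < n.+1) (xDcoef n k%:Z l%:Z)%:~R * phi k l.

Lemma big_nat_vanish (R : nmodType) (m N : nat) (f : nat -> R) : (m <= N)%N ->
  (forall i, (m <= i)%N -> f i = 0) ->
  \sum_(0 <= i < N) f i = \sum_(0 <= i < m) f i.
Proof.
move=> le_mN f0; rewrite (big_cat_nat (n := m)) //= [X in _ + X]big_nat.
by rewrite [X in _ + X]big1 ?addr0 // => i /andP[/f0].
Qed.

Section RowSum.
Variable R : pzRingType.
Implicit Types phi psi : nat -> nat -> R.

Lemma eq_rowsum n phi psi :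
  (forall k l, phi k l = psi k l) -> rowsum n phi = rowsum n psi.
Proof.
by move=> E; apply: eq_bigr => k _; apply: eq_bigr => l _; rewrite E.
Qed.

(** The shifts of indices in [rowsumS] change the shape of the box, which is
    harmless as the added coefficients vanish. *)
Lemma rowsum_box n N M phi : (n < N)%N -> (n < M)%N ->
  \sum_(0 <= k < N) \sum_(0 <= l < M) (xDcoef n k%:Z l%:Z)%:~R * phi k l
  = rowsum n phi.
Proof.
move=> nN nM; rewrite (@big_nat_vanish _ n.+1 N) // => [|k lt_nk].
  apply: eq_bigr => k _; rewrite (@big_nat_vanish _ n.+1 M) // => l lt_nl.
  by rewrite xDcoef_out ?mul0r // => -[]; lia.
by rewrite big1 // => l _; rewrite xDcoef_out ?mul0r // => -[]; lia.
Qed.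

Lemma rowsum0 phi : rowsum 0 phi = phi 0%N 0%N.
Proof. by rewrite /rowsum !big_nat1 mul1r. Qed.

(** Summation by parts: the shifts of (k, l) in the recurrence of the
    coefficients become opposite shifts of the weight phi. *)
Lemma rowsumS n phi :
  rowsum n.+1 phi = rowsum n (fun k l =>
    (k + 2 * l)%:R * phi k l + (n%:Z - k%:Z - 2 * l%:Z)%:~R * phi k l.+1
    + phi k.+1 l).
Proof.
(* The three sums are the three terms of the recurrence. *)
pose c k l : R := (xDcoef n k%:Z l%:Z)%:~R.
transitivity
  (\sum_(0 <= k < n.+2) \sum_(0 <= l < n.+2) c k l * ((k + 2 * l)%:R * phi k l)
   + \sum_(0 <= k < n.+2) \sum_(0 <= l < n.+2)
       ((n%:Z - k%:Z - 2 * l%:Z + 2) * xDcoef n k%:Z (l%:Z - 1))%:~R * phi k l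
   + \sum_(0 <= k < n.+2) \sum_(0 <= l < n.+2)
       (xDcoef n (k%:Z - 1) l%:Z)%:~R * phi k l).
  rewrite -!big_split /=; apply: eq_bigr => k _.
  rewrite -!big_split /=; apply: eq_bigr => l _.
  rewrite 2!intrD 2!mulrDl; congr (_ + _ + _).
  rewrite /c mulrA [(k + 2 * l)%:R]pmulrn -intrM.
  by congr (_%:~R * _); rewrite mulrC; congr (_ * _); lia.
rewrite (rowsum_box (fun k l => (k + 2 * l)%:R * phi k l)) //.
have -> : \sum_(0 <= k < n.+2) \sum_(0 <= l < n.+2)
       ((n%:Z - k%:Z - 2 * l%:Z + 2) * xDcoef n k%:Z (l%:Z - 1))%:~R * phi k l
   = rowsum n (fun k l => (n%:Z - k%:Z - 2 * l%:Z)%:~R * phi k l.+1).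
  rewrite -(@rowsum_box n n.+2 n.+1) //; apply: eq_bigr => k _.
  rewrite big_nat_recl // xDcoef_out; last by case.
  rewrite mulr0 mul0r add0r; apply: eq_bigr => l _.
  rewrite mulrA -intrM mulrC; congr (_ * _); congr (_%:~R).
  by congr (xDcoef _ _ _ * _); lia.
have -> : \sum_(0 <= k < n.+2) \sum_(0 <= l < n.+2)
       (xDcoef n (k%:Z - 1) l%:Z)%:~R * phi k l
   = rowsum n (fun k l => phi k.+1 l).
  rewrite -(@rowsum_box n n.+1 n.+2) // big_nat_recl //.
  rewrite big1 ?add0r => [|l _]; last by rewrite xDcoef_out ?mul0r // => -[].
  apply: eq_bigr => k _; apply: eq_bigr => l _.
  by congr ((xDcoef _ _ _)%:~R * _); lia.
rewrite /rowsum -!big_split /=; apply: eq_bigr => k _.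
by rewrite -!big_split /=; apply: eq_bigr => l _; rewrite !mulrDr.
Qed.

Lemma rowsum_trunc n phi : (0 < n)%N ->
  rowsum n phi = \sum_(1 <= k < n.+1) \sum_(0 <= l < ((2 * n - k) %/ 2).+1)
                   (xDcoef n k%:Z l%:Z)%:~R * phi k l.
Proof.
case: n => // n _; rewrite /rowsum big_nat_recl // big1 ?add0r => [|l _].
  rewrite big_add1; apply: eq_bigr => k _.
  apply: big_nat_vanish => [|l lt_l]; first by lia.
  by rewrite xDcoef_out ?mul0r // => -[]; lia.
by rewrite xDcoefS0 mul0r.
Qed.
End RowSum.

Lemma rmorph_rowsum (R S : pzRingType) (f : {rmorphism R -> S}) n phi :
  f (rowsum n phi) = rowsum n (fun k l => f (phi k l)).
Proof.
rewrite /rowsum rmorph_sum; apply: eq_bigr => k _.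
by rewrite rmorph_sum; apply: eq_bigr => l _; rewrite rmorphM rmorph_int.
Qed.

Lemma mulr_rowsum (R : comPzRingType) (c : R) n phi :
  c * rowsum n phi = rowsum n (fun k l => c * phi k l).
Proof.
rewrite /rowsum mulr_sumr; apply: eq_bigr => k _.
by rewrite mulr_sumr; apply: eq_bigr => l _; rewrite mulrCA.
Qed.

Lemma rowsumD (R : comPzRingType) n (phi psi : nat -> nat -> R) :
  rowsum n phi + rowsum n psi = rowsum n (fun k l => phi k l + psi k l).
Proof.
rewrite /rowsum -big_split; apply: eq_bigr => k _ /=.
by rewrite -big_split; apply: eq_bigr => l _ /=; rewrite -mulrDr.
Qed.

(** * Derivations and the normal form of (x D)^n *)

Section Derivation.
Variables (R : comPzRingType) (d : R -> R).
Hypothesis dD : {morph d : a b / a + b}.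
Hypothesis dM : forall a b, d (a * b) = d a * b + a * d b.

Lemma derivation0 : d 0 = 0.
Proof. by apply: (@addrI _ (d 0)); rewrite -dD !addr0. Qed.

Lemma derivation1 : d 1 = 0.
Proof. by apply: (@addrI _ (d 1)); rewrite addr0 -{3}[1]mulr1 dM mulr1 mul1r. Qed.

Lemma derivation_int (m : int) : d m%:~R = 0.
Proof.
have d_nat n : d n%:R = 0.
  elim: n => [|n IHn]; first exact: derivation0.
  by rewrite -natr1 dD IHn derivation1 addr0.
case: m => n; first exact: d_nat.
apply: (@addrI _ (d n.+1%:R)).
by rewrite -dD NegzE mulrNz /= subrr d_nat addr0 derivation0.
Qed.

Lemma derivation_rowsum n phi :
  d (rowsum n phi) = rowsum n (fun k l => d (phi k l)).
Proof.
rewrite /rowsum (big_morph d dD derivation0); apply: eq_bigr => k _.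
rewrite (big_morph d dD derivation0); apply: eq_bigr => l _.
by rewrite dM derivation_int mul0r add0r.
Qed.
End Derivation.

Section FieldDerivation.
Variables (K : fieldType) (d : K -> K).
Hypothesis dD : {morph d : a b / a + b}.
Hypothesis dM : forall a b, d (a * b) = d a * b + a * d b.

Lemma derivation_expz (u : K) (m : int) : u != 0 ->
  d (u ^ m) = m%:~R * u ^ m * (d u / u).
Proof.
move=> u0.
have d_nat n : d (u ^+ n) = n%:R * u ^+ n * (d u / u).
  elim: n => [|n IHn]; first by rewrite (derivation1 dM) !mul0r.
  by rewrite exprS dM IHn -natr1; field.
case: m => n; first exact: d_nat.
rewrite NegzE -exprnN.
have un0 : u ^+ n.+1 != 0 by rewrite expf_neq0.
(* The product rule for u^-n * u^n = 1 determines the derivative of u^-n. *)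
have /eqP := dM (u ^- n.+1) (u ^+ n.+1).
rewrite mulVf // (derivation1 dM) eq_sym addr_eq0 d_nat => /eqP E.
apply: (mulIf un0); rewrite E mulrNz -pmulrn.
move: (u ^+ n.+1) un0 (n.+1%:R : K) => v v0 c.
by field; rewrite u0.
Qed.

Variables x y : K.
Hypotheses (x0 : x != 0) (y0 : y != 0).

(** The Leibniz rule for x -> y, y -> x: the three terms are those of the
    adjoint recurrence [rowsumS], with a = k + 2 l and m = n - k - 2 l. *)
Lemma xD_monomial (dx : d x = y) (dy : d y = x) (a : nat) (m : int) (g : K) :
  x * d (x ^+ a * y ^ m * g)
  = a%:R * (x ^+ a * y ^ (m + 1) * g)
    + m%:~R * (x ^+ a.+2 * y ^ (m - 1) * g)
    + x ^+ a.+1 * y ^ m * d g.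
Proof.
rewrite !dM (derivation_expz m y0) (derivation_expz a x0) dx dy.
rewrite !expfzDr // expr1z exprN1 !exprS -!exprnP -!pmulrn.
move: (m%:~R : K) (a%:R : K) (x ^+ a) (y ^ m) => M A X Y.
by field; rewrite x0 y0.
Qed.

Lemma iter_xD (dx : d x = y) (dy : d y = x) n f :
  iter n (fun h => x * d h) f
  = rowsum n (fun k l =>
      x ^+ (k + 2 * l) * y ^ (n%:Z - k%:Z - 2 * l%:Z) * iter k d f).
Proof.
elim: n => [|n IHn]; first by rewrite rowsum0 /= !mul1r.
rewrite iterS IHn (derivation_rowsum dD dM) mulr_rowsum rowsumS.
apply: eq_rowsum => k l; rewrite xD_monomial //.
congr (_ * (_ * y ^ _ * _) + _ * (x ^+ _ * y ^ _ * _) + x ^+ _ * y ^ _ * _); lia.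
Qed.
End FieldDerivation.

(** * The generating function of a row *)

(** The ranges of summation defining [Wfun] cover the support of a row, and the
    conventional value at n = 0 is the sum over the row 0. *)
Lemma WfunE (K : fieldType) n (x y z : K) :
  Wfun xDcoef n x y z = rowsum n (fun k l =>
    x ^+ (k + 2 * l) * y ^ (n%:Z - k%:Z - 2 * l%:Z) * z ^+ k).
Proof.
case: n => [|n]; first by rewrite rowsum0 !mul1r.
rewrite rowsum_trunc //; apply: eq_bigr => k _; apply: eq_bigr => l _.
by rewrite !mulrA.
Qed.

(** Here d is the partial derivative with respect to x: x y (1 - x^2/y^2) d
    sends x^a y^m to a x^a y^(m+1) - a x^(a+2) y^(m-1), and n x^2/y turns the
    second coefficient into n - a = m. *)
Lemma WfunS (K : fieldType) (d : K -> K) (x y z : K) n :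
  {morph d : a b / a + b} -> (forall a b, d (a * b) = d a * b + a * d b) ->
  x != 0 -> y != 0 -> d x = 1 -> d y = 0 -> d z = 0 ->
  Wfun xDcoef n.+1 x y z =
    x * (z + n%:R * (x / y)) * Wfun xDcoef n x y z
    + x * y * (1 - x ^+ 2 / y ^+ 2) * d (Wfun xDcoef n x y z).
Proof.
move=> dD dM x0 y0 dx dy dz; rewrite !WfunE (derivation_rowsum dD dM).
rewrite !mulr_rowsum rowsumD rowsumS; apply: eq_rowsum => k l.
have dzk : d (z ^+ k) = 0.
  by elim: k => [|k IHk]; rewrite ?(derivation1 dM) // exprS dM dz IHk; ring.
rewrite !dM dzk (derivation_expz dM _ y0) (derivation_expz dM (k + 2 * l)%N x0).
rewrite dx dy !mul0r !mulr0 !addr0.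
set a := (k + 2 * l)%N; set m := n%:Z - k%:Z - 2 * l%:Z.
have -> : n.+1%:Z - k%:Z - 2 * l%:Z = m + 1 by rewrite /m; lia.
have -> : n.+1%:Z - k%:Z - 2 * l.+1%:Z = m - 1 by rewrite /m; lia.
have -> : n.+1%:Z - k.+1%:Z - 2 * l%:Z = m by rewrite /m; lia.
have -> : (k + 2 * l.+1 = a.+2)%N by rewrite /a; lia.
have -> : (k.+1 + 2 * l = a.+1)%N by rewrite /a; lia.
have -> : n%:R = m%:~R + a%:R :> K.
  by rewrite !pmulrn -intrD /m /a; congr (_%:~R); lia.
(* Expressing every power by x^a, y^m and z^k leaves a rational identity. *)
rewrite !expfzDr // expr1z exprN1 !exprS -!exprnP -!pmulrn.
move: (m%:~R : K) (a%:R : K) (x ^+ a) (y ^ m) (z ^+ k) => M A X Y Z.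
by field; rewrite x0 y0.
Qed.

(** With a weight independent of l, the first two terms of [rowsumS] add up to
    n times the weight. *)
Lemma rowsum_rising (R : comNzRingType) (z : R) n :
  rowsum n (fun k _ => z ^+ k) = \prod_(0 <= i < n) (z + i%:R).
Proof.
elim: n => [|n IHn]; first by rewrite rowsum0 big_nil.
rewrite rowsumS big_nat_recr //= -IHn mulrC mulr_rowsum.
apply: eq_rowsum => k l; rewrite exprS -!mulrDl addrC; congr (_ * _).
by rewrite [(k + 2 * l)%:R]pmulrn -intrD [n%:R]pmulrn; congr (_ + _%:~R); lia.
Qed.

(** * Permutations of n + 1 points from permutations of n points *)

(** A permutation of n + 1 points is determined by the preimage j of the last
    point and by the permutation of n points left when this point is removed.
    Any family h j of injections into the permutations sending j to the last
    point realizes this, by counting: (n + 1)! = (n + 1) n!. *)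
Lemma sum_Sn_split (R : nmodType) n (h : 'I_n.+1 -> 'S_n -> 'S_n.+1)
    (f : 'S_n.+1 -> R) :
  (forall j s, h j s j = ord_max) -> (forall j, injective (h j)) ->
  \sum_s f s = \sum_(s : 'S_n) \sum_(j < n.+1) f (h j s).
Proof.
move=> h_max h_inj; rewrite pair_big /=.
pose g (u : 'S_n * 'I_n.+1) := h u.2 u.1.
have g_inj : injective g.
  move=> [s j] [t i]; rewrite /g /= => E.
  have ij : j = i by apply: (@perm_inj _ (h j s)); rewrite [in RHS]E !h_max.
  by rewrite ij in E *; rewrite (h_inj _ _ _ E).
rewrite (reindex g) //; apply/onW_bij/inj_card_bij => //.
by rewrite card_prod !card_Sn card_ord factS mulnC.
Qed.

(** * Cycles *)

Lemma porbit_lift_perm n (s : 'S_n) (x : 'I_n) :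
  porbit (lift_perm ord_max ord_max s) (lift ord_max x)
  = lift ord_max @: porbit s x.
Proof.
have liftX i y : (lift_perm ord_max ord_max s ^+ i)%g (lift ord_max y)
    = lift ord_max ((s ^+ i)%g y).
  elim: i y => [|i IHi] y; first by rewrite !expg0 !perm1.
  by rewrite !expgS !permM lift_perm_lift IHi.
apply/setP => z; apply/porbitP/imsetP => [[i ->]|[y /porbitP[i ->] ->]].
  by exists ((s ^+ i)%g x); [apply/porbitP; exists i | rewrite liftX].
by exists i; rewrite liftX.
Qed.

Lemma porbit_lift_perm_max n (s : 'S_n) :
  porbit (lift_perm ord_max ord_max s) ord_max = [set ord_max].
Proof.
apply/setP => z; rewrite inE; apply/porbitP/eqP => [[i ->]|->].
  elim: i => [|i IHi]; first by rewrite expg0 perm1.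
  by rewrite expgS permM lift_perm_id.
by exists 0%N; rewrite expg0 perm1.
Qed.

(** The orbits of the extended permutation are those of s and the new fixed
    point. *)
Lemma card_porbits_lift_perm n (s : 'S_n) :
  #|porbits (lift_perm ord_max ord_max s)| = #|porbits s|.+1.
Proof.
have -> : porbits (lift_perm ord_max ord_max s)
    = [set ord_max] |: [set lift ord_max @: A | A : {set 'I_n} in porbits s].
  apply/setP => A; rewrite !inE; apply/imsetP/orP.
    case=> x _ ->; case: (unliftP ord_max x) => [y ->|->].
      right; apply/imsetP; exists (porbit s y); first exact: imset_f.
      exact: porbit_lift_perm.
    by left; rewrite porbit_lift_perm_max.
  case=> [/eqP ->|/imsetP[_ /imsetP[y _ ->] ->]].
    by exists ord_max; rewrite ?porbit_lift_perm_max.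
  by exists (lift ord_max y); rewrite ?porbit_lift_perm.
rewrite cardsU1 card_imset; last exact/imset_inj/lift_inj.
case: imsetP => // -[A _ E].
have : ord_max \in lift ord_max @: A by rewrite -E inE.
by case/imsetP => y _ /eqP; rewrite (negPf (neq_lift _ _)).
Qed.

(** Multiplying by the transposition of j and the fixed point merges that point
    into the cycle of j, unless j is itself the fixed point. *)
Lemma card_porbits_tperm_lift n (s : 'S_n) (j : 'I_n.+1) :
  #|porbits (tperm j ord_max * lift_perm ord_max ord_max s)%g|
  = (#|porbits s| + (j == ord_max))%N.
Proof.
have := porbits_mul_tperm (lift_perm ord_max ord_max s) j ord_max.
rewrite porbit_lift_perm_max inE card_porbits_lift_perm.
by case: eqVneq => [->|_] /=; rewrite ?tperm1 ?mul1g; lia.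
Qed.

Lemma sum_porbits (R : comNzRingType) (z : R) n :
  \sum_(s : 'S_n) z ^+ #|porbits s| = \prod_(0 <= i < n) (z + i%:R).
Proof.
elim: n => [|n IHn].
  rewrite big_nil (big_pred1 (1%g : 'S_0)) => [|s]; last first.
    by apply/esym/eqP/permP => -[].
  have -> : porbits (1 : 'S_0)%g = set0.
    by apply/setP => A; rewrite inE; apply/imsetP => -[[]].
  by rewrite cards0.
rewrite (@sum_Sn_split _ _
  (fun j s => tperm j ord_max * lift_perm ord_max ord_max s)%g).
- rewrite big_nat_recr // -IHn /= mulr_suml; apply: eq_bigr => s _.
  under eq_bigr do rewrite card_porbits_tperm_lift.
  rewrite big_ord_recr /= eqxx addn1 exprSr mulrDr addrC; congr (_ + _).
  rewrite (eq_bigr (fun=> z ^+ #|porbits s|)) => [|i _].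
    by rewrite sumr_const card_ord mulr_natr.
  by rewrite -val_eqE /= ltn_eqF ?addn0.
- by move=> j s; rewrite permM tpermL lift_perm_id.
move=> j s t /mulgI E; apply/permP => x; apply: (@lift_inj _ ord_max).
by rewrite -!(lift_perm_lift ord_max) E.
Qed.

Lemma prod_stirling1 (R : comNzRingType) (z : R) n : (0 < n)%N ->
  \prod_(0 <= i < n) (z + i%:R)
  = \sum_(1 <= k < n.+1) (stirling1 n k)%:R * z ^+ k.
Proof.
move=> n_gt0; rewrite -sum_porbits.
have cycles_bound (s : 'S_n) : (0 < #|porbits s| < n.+1)%N.
  apply/andP; split.
    by apply/card_gt0P; exists (porbit s (Ordinal n_gt0)); apply: imset_f.
  by rewrite ltnS -[n in leqRHS]card_ord; apply: leq_imset_card.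
transitivity (\sum_(s : 'S_n) \sum_(1 <= k < n.+1)
                (if #|porbits s| == k then z ^+ k else 0)).
  apply: eq_bigr => s _; rewrite -big_mkcond /=.
  by under eq_bigl do rewrite eq_sym; rewrite big_nat1_eq cycles_bound.
rewrite exchange_big /=; apply: eq_bigr => k _; rewrite -big_mkcond /=.
rewrite sumr_const mulr_natl; congr (_ *+ _).
by apply: eq_card => s; rewrite !inE.
Qed.

(** * Alternating runs and changes of direction *)

(** The steps of the word x s: true for a rise, false for a descent. *)
Definition rises (x : nat) (s : seq nat) : seq bool := pairmap ltn x s.

(** The direction a is that of the step preceding ds. *)
Fixpoint turns (a : bool) (ds : seq bool) : nat :=
  if ds is b :: ds' then ((a (+) b) + turns b ds')%N else 0%N.

(** The effect on the steps of inserting a new maximum after p letters: the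
    step at p becomes a rise followed by a descent, and at the end of the word a
    rise is appended. *)
Fixpoint add_peak (p : nat) (ds : seq bool) {struct ds} : seq bool :=
  match ds, p with
  | [::], _ => [:: true]
  | _ :: ds', 0 => [:: true, false & ds']
  | b :: ds', p'.+1 => b :: add_peak p' ds'
  end.

Lemma rises_insert x M s p : (x < M)%N -> all (gtn M) s ->
  rises x (take p s ++ M :: drop p s) = add_peak p (rises x s).
Proof.
rewrite /rises.
elim: s x p => [|y s IHs] x p xM /=; first by rewrite xM.
case/andP=> yM sM; case: p => [|p] /=; last by rewrite IHs.
by rewrite xM ltnNge (ltnW yM).
Qed.

Section AlternatingRuns.
Variable w : seq nat.
Hypothesis w_uniq : uniq w.
Let d i := (nth 0%N w i < nth 0%N w i.+1)%N.

(** Distinctness of the entries makes a step that is not a rise a descent. *)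
Lemma monotone_factorP i j : (j < size w)%N ->
  reflect ((i < j)%N /\ exists b, forall k, (i <= k < j)%N -> d k = b)
          (monotone_factor w i j).
Proof.
move=> jw.
have sz : size (factor w i j) = (j.+1 - i)%N.
  by rewrite size_drop size_takel.
have sorted_nth (e : rel nat) : reflect
    (forall k, (i <= k < j)%N -> e (nth 0%N w k) (nth 0%N w k.+1)%N)
    (sorted e (factor w i j)).
  apply: (iffP (sortedP 0%N)) => H k; rewrite ?sz => Hk.
    have := H (k - i)%N; rewrite sz !nth_drop !nth_take; try lia.
    by rewrite addnS subnKC; [apply; lia | lia].
  rewrite !nth_drop !nth_take; try lia.
  by rewrite addnS; apply: H; lia.
apply: (iffP andP) => -[ij H]; split=> //.
  case/orP: H => /sorted_nth H; [exists true | exists false] => k /H //=.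
  by rewrite /d => lt_k; rewrite ltnNge ltnW.
case: H => -[] H; apply/orP; [left | right]; apply/sorted_nth => k Hk.
  exact: H.
have := H k Hk; rewrite /d /= => /negbT; rewrite -leqNgt leq_eqVlt.
have kw : (k.+1 < size w)%N by lia.
by rewrite nth_uniq ?(ltnW kw) // gtn_eqF.
Qed.

Definition run_start i := (i.+1 < size w)%N && ((i == 0%N) || (d i.-1 != d i)).

(** If the step before i had the direction of the step at i, the run could be
    extended to the left. *)
Lemma run_startP (i j : 'I_(size w)) : alternating_run i j -> run_start i.
Proof.
case/andP => mij /forallP maxij.
have [ij [b db]] := monotone_factorP i (ltn_ord j) mij.
apply/andP; split; first by have := ltn_ord j; lia.
apply/orP; case: (posnP i) => [->|i0]; [by left | right].
apply/eqP => di.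
have i'w : (i.-1 < size w)%N by have := ltn_ord i; lia.
have := forallP (maxij (Ordinal i'w)) j; rewrite leq_pred leqnn /=.
have -> /= : monotone_factor w i.-1 j.
  apply/monotone_factorP => //; split; first by lia.
  exists b => k Hk; have [ik|ik] := leqP i k; first by apply: db; lia.
  have -> : k = i.-1 by lia.
  by rewrite di db // leqnn.
by case/andP => /eqP/(congr1 val) /=; lia.
Qed.

(** The run is the longest monotone factor starting at i: it cannot be extended
    to the right, nor to the left since the direction changes at i. *)
Lemma run_of_start (i : 'I_(size w)) : run_start i ->
  exists j, alternating_run i j.
Proof.
case/andP => iw turn_i.
have mi : monotone_factor w i (Ordinal iw).
  apply/monotone_factorP => //=; split=> //; exists (d i) => k Hk.
  by have -> : k = i by lia.
have [j mij maxj] := @arg_maxnP _ _ (fun j : 'I_(size w) => monotone_factor w i j)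
  (fun j => val j) mi.
exists j; rewrite /alternating_run mij /=.
apply/forallP => i'; apply/forallP => j'; apply/implyP => /and3P[i'i jj' m'].
have [_ [b db]] := monotone_factorP i' (ltn_ord j') m'.
have [ij _] := monotone_factorP i (ltn_ord j) mij.
have ii' : i' = i.
  apply/val_inj => /=; apply/eqP; rewrite eqn_leq i'i leqNgt; apply/negP => lt_i.
  case/orP: turn_i => [/eqP|/eqP]; first by lia.
  by apply; rewrite !db //; lia.
rewrite ii' eqxx /=; apply/eqP/val_inj => /=; apply/eqP.
by rewrite eqn_leq jj' andbT; apply: maxj; rewrite -ii'.
Qed.

(** Two maximal monotone factors with the same start are comparable, hence
    equal, so the runs are counted by their starts. *)
Lemma altrunsE : altruns w = #|[set i : 'I_(size w) | run_start i]|.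
Proof.
rewrite /altruns -(card_in_imset (f := fst)); last first.
  move=> [i j] [i' j']; rewrite !inE /= => /andP[mij /forallP Mij].
  move=> /andP[mij' /forallP Mij'] E; move: E mij' Mij' => <- mij' Mij'.
  congr pair; have [jj'|/ltnW j'j] := leqP j j'.
    have := forallP (Mij i) j'; rewrite leqnn jj' mij' eqxx /=.
    by move/eqP.
  by have := forallP (Mij' i) j; rewrite leqnn j'j mij eqxx /= => /eqP.
apply: eq_card => i; rewrite [in RHS]inE; apply/imsetP/idP => [[[i' j]]|].
  by rewrite inE /= => /run_startP H ->.
by case/run_of_start => j H; exists (i, j); rewrite ?inE.
Qed.
End AlternatingRuns.

Lemma turnsE a ds : turns a ds =
  (\sum_(i < size ds) (nth a (a :: ds) i (+) nth a ds i))%N.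
Proof.
elim: ds a => [|b ds IHds] a /=; first by rewrite big_ord0.
rewrite big_ord_recl /= IHds; congr addn; apply: eq_bigr => i _ /=.
rewrite (set_nth_default a b) ?(set_nth_default a b (ltn_ord i)) //.
by rewrite /=; have := ltn_ord i; lia.
Qed.

(** The letter 0 is smaller than the others, so the first step is a rise; with
    false as direction before the word, it counts as a turn, like every other
    start of a run. *)
Lemma altruns_turns s : uniq (0%N :: s) ->
  altruns (0%N :: s) = turns false (rises 0 s).
Proof.
move=> s_uniq; rewrite altrunsE // turnsE -sum1_card /= big_mkcond.
rewrite big_ord_recr /= inE /run_start ltnn addn0 /rises.
rewrite size_pairmap; apply: eq_bigr => -[[|i] lt_is] _.
  rewrite inE /= ltnS lt_is (nth_pairmap 0%N) //=.
  case: s s_uniq lt_is => //= y s; rewrite inE; lia.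
rewrite inE /= ltnS lt_is /= (nth_pairmap 0%N) ?(nth_pairmap 0%N) //=; try lia.
by case: (_ < _)%N; case: (_ < _)%N.
Qed.

(** * The recurrence of the up-down run polynomials *)

Section PeakSum.
Variables (R : comNzRingType) (x : R).

Definition peaksum a ds : R :=
  \sum_(p < (size ds).+1) x ^+ turns a (add_peak p ds).

Lemma peaksum_nil a : peaksum a [::] = x ^+ (~~ a).
Proof. by rewrite /peaksum big_ord1 /= addn0; case: a. Qed.

Lemma peaksum_cons a b ds : peaksum a (b :: ds) =
  x ^+ (~~ a + (1 + turns false ds)) + x ^+ (a (+) b) * peaksum b ds.
Proof.
rewrite /peaksum big_ord_recl /= addbT mulr_sumr; congr (_ + _).
by apply: eq_bigr => p _; rewrite /= -exprD.
Qed.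

(** Inserting a peak keeps the number r of turns at r places, increases it by 1
    at one place and by 2 elsewhere. Peeling off the first step leads to
    [peaksum true], whose closed form depends on the first step of ds. To avoid
    that case distinction, x * peaksum true ds is obtained from the statement
    for true :: ds; this is why the induction is on the length, with two steps
    peeled off when the first is a rise. *)
Lemma peaksumE ds :
  let r := turns false ds in
  peaksum false ds =
  r%:R * x ^+ r + x ^+ r.+1 + ((size ds)%:R - r%:R) * x ^+ r.+2.
Proof.
have [m] := ubnP (size ds); elim: m ds => // m IHm [|[] ds].
- by rewrite /= peaksum_nil => _; ring.
- case: ds => [|[] ds] /=.
  + by rewrite peaksum_cons peaksum_nil /= => _; ring.
  + move=> lt_m; have := IHm (true :: ds) lt_m.
    rewrite !peaksum_cons /= !add0n !add1n => E.
    (* [peaksum_cons] for true :: ds, solved for x * peaksum true ds. *)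
    have {}E : x ^+ 1 * peaksum true ds
      = (turns true ds).+1%:R * x ^+ (turns true ds).+1 + x ^+ (turns true ds).+2
      + ((size ds).+1%:R - (turns true ds).+1%:R) * x ^+ (turns true ds).+3
      - x ^+ (turns false ds).+2 by rewrite -E; ring.
    rewrite expr0 mul1r mulrDr E !exprS -!natr1; ring.
  + move=> lt_m; have := IHm ds (ltnW lt_m); rewrite !peaksum_cons /= => ->.
    by rewrite !add0n !add1n !exprS -!natr1; ring.
move=> lt_m; have := IHm ds lt_m; rewrite peaksum_cons /= => ->.
by rewrite !add0n !add1n !exprS -!natr1; ring.
Qed.
End PeakSum.

(** Here [lift_perm p ord_max s] inserts the new maximum at the place p of the
    word of s and keeps the order of the other letters. *)
Lemma word_lift_perm n (p : 'I_n.+1) (s : 'S_n) :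
  let w := [seq (s i).+1 | i <- enum 'I_n] in
  [seq (lift_perm p ord_max s i).+1 | i <- enum 'I_n.+1]
  = take p w ++ n.+1 :: drop p w.
Proof.
move=> w.
have sw : size w = n by rewrite size_map size_enum_ord.
have pn : (p <= n)%N by rewrite -ltnS.
apply: (@eq_from_nth _ 0%N) => [|k].
  rewrite size_cat /= size_takel ?sw // size_drop sw size_map size_enum_ord.
  by rewrite addnS subnKC.
rewrite size_map size_enum_ord => kn; pose i := Ordinal kn.
rewrite (nth_map i) ?size_enum_ord // (_ : nth _ _ _ = i); last first.
  by apply: val_inj; rewrite /= nth_enum_ord.
rewrite nth_cat size_takel ?sw //.
have [j Ej|Ei] := unliftP p i; last first.
  have kp : k = p by rewrite -Ei.
  by rewrite Ei lift_perm_id kp ltnn subnn.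
have Ek : k = bump p j by rewrite -[k]/(val i) Ej.
have nth_w : nth 0%N w j = (s j).+1.
  rewrite (nth_map j) ?size_enum_ord //; congr (val (s _)).+1.
  by apply: val_inj; rewrite /= nth_enum_ord.
rewrite Ej lift_perm_lift lift_max -nth_w Ek /bump.
have [pj|jp] := leqP p j.
  rewrite add1n ltnNge (leqW pj) /= subSn //= nth_drop subnKC //.
by rewrite add0n jp nth_take.
Qed.

Lemma word_uniq n (s : 'S_n) : uniq (0%N :: [seq (s i).+1 | i <- enum 'I_n]).
Proof.
rewrite /= map_inj_uniq ?enum_uniq ?andbT => [|i j [/val_inj/perm_inj //]].
by apply/mapP => -[].
Qed.

(** A word with r runs contributes r X^r + X^(r+1) + (n - r) X^(r+2), which is
    (X + n X^2) X^r + (X - X^3) (X^r)'. *)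
Lemma TpolyS (R : comNzRingType) n :
  Tpoly R n.+1 = ('X + n%:R * 'X^2) * Tpoly R n + ('X - 'X^3) * (Tpoly R n)^`().
Proof.
rewrite /Tpoly (@sum_Sn_split _ _ (fun p s => lift_perm p ord_max s)); last 2 first.
- by move=> p s; rewrite lift_perm_id.
- move=> p s t E; apply/permP => i; apply: (@lift_inj _ ord_max).
  by rewrite -!(lift_perm_lift p) E.
rewrite raddf_sum !mulr_sumr -big_split /=; apply: eq_bigr => s _.
pose w := [seq (s i).+1 | i <- enum 'I_n].
have size_w : size (rises 0 w) = n by rewrite size_pairmap size_map size_enum_ord.
have -> : udrun s = turns false (rises 0 w) by rewrite -altruns_turns // word_uniq.
transitivity (peaksum ('X : {poly R}) false (rises 0 w)).
  rewrite /peaksum size_w; apply: eq_bigr => p _; congr (_ ^+ _).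
  rewrite /udrun altruns_turns ?word_uniq // word_lift_perm rises_insert //.
  by apply/allP => _ /mapP[i _ ->] /=; rewrite ltnS.
rewrite peaksumE size_w derivXn.
case: (turns _ _) => [|r]; first by rewrite mulr0n; ring.
by rewrite -mulr_natl !exprS /=; ring.
Qed.

Lemma Tpoly_rowsum (R : comNzRingType) n :
  Tpoly R n = rowsum n (fun k l => 'X^(k + 2 * l)).
Proof.
elim: n => [|n IHn].
  (* The empty permutation has the word 0, without runs. *)
  rewrite rowsum0 /Tpoly (big_pred1 (1%g : 'S_0)) => [|s]; last first.
    by apply/esym/eqP/permP => -[].
  by rewrite /udrun altruns_turns ?word_uniq // (size0nil (size_enum_ord 0)).
rewrite TpolyS IHn (derivation_rowsum (@derivD _) (@derivM _)) !mulr_rowsum.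
rewrite rowsumD rowsumS; apply: eq_rowsum => k l.
have -> : (k + 2 * l.+1 = (k + 2 * l).+2)%N by lia.
have -> : (k.+1 + 2 * l = (k + 2 * l).+1)%N by lia.
have -> : (n%:Z - k%:Z - 2 * l%:Z)%:~R = n%:R - (k + 2 * l)%:R :> {poly R}.
  by rewrite !pmulrn -intrB; congr (_%:~R); lia.
rewrite derivXn; case: (k + 2 * l)%N => [|a]; first by rewrite mulr0n; ring.
by rewrite -mulr_natl !exprS /=; ring.
Qed.

Lemma Wfun_Tpoly (K : fieldType) n (x y : K) : y != 0 ->
  Wfun xDcoef n x y 1 = y ^+ n * (Tpoly K n).[x / y].
Proof.
move=> y0; rewrite WfunE Tpoly_rowsum -[_.[_]]/(horner_eval (x / y) _).
rewrite rmorph_rowsum mulr_rowsum; apply: eq_rowsum => k l.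
rewrite /= horner_evalE hornerXn expr1n mulr1 exprMn mulrCA; congr (_ * _).
have -> : n%:Z - k%:Z - 2 * l%:Z = n%:Z - (k + 2 * l)%:Z by lia.
by rewrite expfzDr // -exprnN exprVn.
Qed.

(** * Variables of the field of rational functions *)

Lemma rvar_neq0 (F : fieldType) n (i : 'I_n) : rvar F i != 0.
Proof.
rewrite tofrac_eq0; apply/eqP => /(congr1 (mcoeff U_(i)%MM)).
by rewrite mcoeffXU eqxx mcoeff0 => /eqP; rewrite oner_eq0.
Qed.

Lemma pderiv_rvar (F : fieldType) n (i j : 'I_n) :
  pderiv i (rvar F j) = (i == j)%:R.
Proof.
rewrite pderiv_poly mderivX mnm1E eq_sym.
case: eqVneq => [->|_]; last by rewrite scale0r tofrac0.
by rewrite scale1r -[X in (X - _)%MM]add0m addmK mpolyX0 tofrac1.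
Qed.

Theorem proposition22 (F : fieldType) (charF0 : [pchar F] =i pred0) :
  exists W : nat -> int -> int -> int,
    (* (i) *)
    [/\ (forall n : nat, (1 <= n)%N ->
          let x : ratfun F 2 := rvar F 0 in
          let y : ratfun F 2 := rvar F 1 in
          let D : ratfun F 2 -> ratfun F 2 := gderiv (@Gprime F) in
          forall f : ratfun F 2,
            iter n (fun h => x * D h) f =
            \sum_(1 <= k < n.+1) \sum_(0 <= l < ((2 * n - k) %/ 2).+1)
              (W n k%:Z l%:Z)%:~R * x ^+ (k + 2 * l) *
              y ^ (n%:Z - k%:Z - 2 * l%:Z) * iter k D f),
        (forall n : nat, (1 <= n)%N -> forall k l : int,
          W n.+1 k l =
            (k + 2 * l) * W n k l + (n%:Z - k - 2 * l + 2) * W n k (l - 1)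
            + W n (k - 1) l),
        W 1%N 1 0 = 1 &
        (forall k l : int, (k, l) <> (1, 0) -> W 1%N k l = 0)]
    /\
    (* (ii) *)
    let x : ratfun F 3 := rvar F 0 in
    let y : ratfun F 3 := rvar F 1 in
    let z : ratfun F 3 := rvar F 2 in
    [/\ (forall n : nat,
          Wfun W n.+1 x y z =
            x * (z + n%:R * (x / y)) * Wfun W n x y z
            + x * y * (1 - x ^+ 2 / y ^+ 2) * pderiv 0 (Wfun W n x y z)),
        Wfun W 0 x y z = 1,
        (forall n : nat, (1 <= n)%N ->
          Wfun W n 1 1 z = \prod_(0 <= i < n) (z + i%:R)
          /\ \prod_(0 <= i < n) (z + i%:R)
             = \sum_(1 <= k < n.+1) (stirling1 n k)%:R * z ^+ k) &
        (forall n : nat, (1 <= n)%N ->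
          Wfun W n x y 1 = y ^+ n * (Tpoly (ratfun F 3) n).[x / y])].
Proof.
exists xDcoef; split; first split.
- move=> n n_gt0 x y D f.
  have Dx : D x = y by exact: gderiv_var.
  have Dy : D y = x by exact: gderiv_var.
  rewrite (iter_xD (gderivD _) (gderivM _) (rvar_neq0 _ _) (rvar_neq0 _ _) Dx Dy).
  rewrite rowsum_trunc //; apply: eq_bigr => k _; apply: eq_bigr => l _.
  by rewrite !mulrA.
- by [].
- by [].
- exact: xDcoef1.
move=> x y z; split=> //.
- move=> n; apply: (WfunS n (@pderivD _ _ _) (@pderivM _ _ _));
    by rewrite ?rvar_neq0 ?pderiv_rvar.
- move=> n n_gt0; split; last exact: prod_stirling1.
  rewrite WfunE -rowsum_rising; apply: eq_rowsum => k l.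
  by rewrite expr1n exp1rz !mul1r.
by move=> n _; apply: Wfun_Tpoly; apply: rvar_neq0.
Qed.
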